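(* Let $A:\mathbb{R}^n\to\mathbb{R}^m$ be linear, let $f:\mathbb{R}^n\to\mathbb{R}\cup\{\infty\}$ be proper, closed and strongly convex with modulus $\mu_f>0$, let $g:\mathbb{R}^m\to\mathbb{R}\cup\{\infty\}$ be proper, closed and convex, with $A\,\mathrm{dom}\, f\cap\mathrm{dom}\, g\neq\emptyset$, and let $\gamma>0$. Then the alternating minimization envelope $\psi_\gamma(y)=-\mathcal{L}_\gamma(x(y),z_\gamma(y),y)$ is the forward-backward envelope (with stepsize $\gamma$) associated with the dual problem $\min_y f^*(-A^\top y)+g^*(y)$; that is, for all $y\in\mathbb{R}^m$, $$\psi_\gamma(y)=f^*(-A^\top y)+g^*(T_\gamma(y))+\tfrac{\gamma}{2}\|Ax(y)-z_\gamma(y)\|^2+\gamma\langle Ax(y),\,z_\gamma(y)-Ax(y)\rangle .$$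
   Context: $\langle\cdot,\cdot\rangle$ is an inner product with induced norm $\|\cdot\|$; $A^\top$ is the adjoint of $A$; $h^*$ is the Fenchel conjugate of $h$; strong convexity of $f$ with modulus $\mu_f$ means $f-\frac{\mu_f}{2}\|\cdot\|^2$ is convex (so $f^*$ is differentiable with $\mu_f^{-1}$-Lipschitz gradient). The augmented Lagrangian is $\mathcal{L}_\gamma(x,z,y)=f(x)+g(z)+\langle y,Ax-z\rangle+\frac{\gamma}{2}\|Ax-z\|^2$. Define $x(y)=\arg\min_x\{f(x)+\langle y,Ax\rangle\}=\nabla f^*(-A^\top y)$, $z_\gamma(y)=\arg\min_z\mathcal{L}_\gamma(x(y),z,y)$, and $T_\gamma(y)=\mathrm{prox}_{\gamma g^*}(y+\gamma A\nabla f^*(-A^\top y))=y+\gamma(Ax(y)-z_\gamma(y))$, where $\mathrm{prox}_{\gamma h}(v)=\arg\min_w\{h(w)+\frac{1}{2\gamma}\|w-v\|^2\}$. The forward-backward envelope with stepsize $\gamma$ of a sum $F+G$, with $F$ differentiable and $G$ proper closed convex, is the function $y\mapsto\min_w\{F(y)+\langle\nabla F(y),w-y\rangle+G(w)+\frac{1}{2\gamma}\|w-y\|^2\}$; here it is taken with $F(y)=f^*(-A^\top y)$ and $G=g^*$. *)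

(* Defs.v *)
From HB Require Import structures.
From mathcomp Require Import all_boot all_order all_algebra.
From mathcomp Require Import all_classical all_reals all_analysis.

Set Implicit Arguments.
Unset Strict Implicit.
Unset Printing Implicit Defensive.

Import Order.TTheory GRing.Theory Num.Theory.
Import numFieldNormedType.Exports.

Local Open Scope classical_set_scope.
Local Open Scope ring_scope.
Local Open Scope ereal_scope.

(* R^n is 'cV[R]_n with its canonical (product) topology. The inner product is
   an arbitrary positive definite symmetric form {dot 'cV[R]_n for idfun}; all
   norms being equivalent, closedness and Frechet differentiability do not
   depend on using the library's norm rather than the one induced by the inner
   product.
   Functions into R \cup {+oo} are \bar R-valued; that they avoid -oo is part
   of [proper_fun]. The adjoint, gradients and minimizers are picked with
   [xget], whose default value 0 is only returned when no such object exists. *)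

Section Euclidean.
Context {R : realType} {n : nat}.
Local Notation V := 'cV[R]_n.
Implicit Types (h : V -> \bar R) (x y v w : V).

Definition proper_fun h : Prop :=
  (forall x, h x != -oo) /\ (exists x, h x < +oo).

Definition closed_fun h : Prop :=
  closed [set p : V * R | h p.1 <= p.2%:E].

(* Only meaningful for functions avoiding -oo. The convention 0 * +oo = 0 makes
   the end points t = 0, 1 harmless. *)
Definition convex_fun h : Prop :=
  forall x y (t : R), (0 <= t <= 1)%R ->
    h (t *: x + (1 - t) *: y)%R <= t%:E * h x + (1 - t)%:E * h y.

Definition argmin h : V := xget 0%R [set x | forall w, h x <= h w].

Variable ip : {dot V for idfun}.

Definition inorm v : R := Num.sqrt (ip v v).

Definition strongly_convex (mu : R) h : Prop :=
  convex_fun (fun x => h x - (mu / 2 * inorm x ^+ 2)%:E).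

Definition conjugate h v : \bar R :=
  ereal_sup (range (fun x => (ip v x)%:E - h x)).

Definition is_gradient h y v : Prop :=
  [/\ \forall w \near y, h w \is a fin_num,
      differentiable (fine \o h : V -> R) y
    & forall u : V, 'd (fine \o h : V -> R) y u = ip v u].

Definition gradient h y : V := xget 0%R [set v | is_gradient h y v].

Definition prox (gamma : R) h v : V :=
  argmin (fun w => h w + (1 / (2 * gamma) * inorm (w - v) ^+ 2)%:E).

Definition is_min (S : set (\bar R)) (a : \bar R) : Prop :=
  S a /\ forall b, S b -> a <= b.

(* The standing assumptions under which the envelope is defined (F
   differentiable, G proper closed convex) are part of the predicate. *)
Definition is_forward_backward_envelope (gamma : R) (F G phi : V -> \bar R) :
    Prop :=
  [/\ forall y, exists v, is_gradient F y v,
      [/\ proper_fun G, closed_fun G & convex_fun G]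
    & forall y,
        is_min (range (fun w => F y + (ip (gradient F y) (w - y))%:E + G w
                                + (1 / (2 * gamma) * inorm (w - y) ^+ 2)%:E))
               (phi y)].

End Euclidean.

Section AlternatingMinimization.
Context {R : realType} {n m : nat}.
Variables (ipn : {dot 'cV[R]_n for idfun}) (ipm : {dot 'cV[R]_m for idfun}).
Variable A : {linear 'cV[R]_n -> 'cV[R]_m}.
Variables (f : 'cV[R]_n -> \bar R) (g : 'cV[R]_m -> \bar R) (gamma : R).
Implicit Types (x : 'cV[R]_n) (y z : 'cV[R]_m).

Definition adjoint y : 'cV[R]_n :=
  xget 0%R [set v | forall x, ipm (A x) y = ipn x v].

Definition augmented_lagrangian x z y : \bar R :=
  f x + g z + (ipm y (A x - z))%:E
  + (gamma / 2 * inorm ipm (A x - z) ^+ 2)%:E.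

Definition xmin y : 'cV[R]_n := argmin (fun x => f x + (ipm y (A x))%:E).

Definition zmin y : 'cV[R]_m :=
  argmin (fun z => augmented_lagrangian (xmin y) z y).

Definition fb_step y : 'cV[R]_m :=
  prox ipm gamma (conjugate ipm g)
    (y + gamma *: A (gradient ipn (conjugate ipn f) (- adjoint y)))%R.

Definition alternating_minimization_envelope y : \bar R :=
  - augmented_lagrangian (xmin y) (zmin y) y.

End AlternatingMinimization.

(* Main.v *)
(* For fixed y put a = A x(y) and z = z_gamma(y). The function minimized by z is g
   plus a quadratic of modulus gamma, so quadratic growth around its minimizer says
   that w0 = y + gamma (a - z) is a subgradient of g at z. Then z is a subgradient
   of g* at w0 = v - gamma z, with v = y + gamma a, which is the optimality
   condition for w0 = prox_{gamma g*} v = T_gamma y; moreover Fenchel's equality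
   evaluates g* w0, and the same affine minorant w |-> <w, z> - g z of g* shows that
   w0 attains the forward-backward envelope. On the f side, quadratic growth around
   x(y) bounds the error of the linearization of f* at -A^T y by |.|^2 / (2 mu), so
   x(y) is its gradient. Minimizers of closed strongly convex functions exist by
   compactness and coercivity, without any separation theorem. *)
Require Import Defs.
From HB Require Import structures.
From mathcomp Require Import all_boot all_order all_algebra.
From mathcomp Require Import all_classical all_reals all_analysis.
From mathcomp Require Import ring lra.

Set Implicit Arguments.
Unset Strict Implicit.
Unset Printing Implicit Defensive.

Import Order.TTheory GRing.Theory Num.Theory.
Import numFieldNormedType.Exports.

Local Open Scope ring_scope.
Local Open Scope ereal_scope.

(** * Inner products on column vectors: Riesz representation, compact balls, continuity,
    gradients *)

Section DotTheory.
Local Open Scope ring_scope.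
Local Open Scope classical_set_scope.
Context {R : realType} {n : nat} (ip : {dot 'cV[R]_n for idfun}).
Local Notation V := 'cV[R]_n.
Implicit Types (x y u v w : V) (a : R).

(** A quadratic error is negligible against the displacement, and the differential is unique. *)
Lemma differentiable_quadratic (U W : normedModType R)
    (f : U -> W) (L : {linear U -> W}) (y : U) (C : R) :
  continuous L ->
  (forall d, `|f (d + y) - f y - L d| <= C * `|d| ^+ 2) ->
  differentiable f y /\ 'd f y = L :> (U -> W).
Proof.
move=> LC hC.
have fE : f \o shift y = cst (f y) + L +o_ 0 id.
  apply/eqaddoP => e e0; near=> d.
  rewrite [leLHS](_ : _ = `|f (d + y) - f y - L d|); last first.
    by rewrite -addrA -opprD.
  apply: le_trans (hC d) _; rewrite expr2 mulrA ler_wpM2r//.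
  (* [C] may have any sign; [|C| + 1] is a positive bound that can be divided by. *)
  rewrite (@le_trans _ _ ((`|C| + 1) * `|d|))//.
    by rewrite ler_wpM2r// (le_trans (ler_norm _))// lerDl.
  rewrite mulrC -ler_pdivlMr; last by rewrite ltr_wpDl.
  by near: d; apply: nbhs0_le; apply: divr_gt0 => //; rewrite ltr_wpDl.
have dL := diff_unique LC fE.
by split=> //; apply/diff_locallyP; rewrite dL.
Unshelve. all: by end_near. Qed.

Lemma dotC x y : ip x y = ip y x.
Proof. by rewrite (@hermitian_subproof _ _ _ _ ip) expr0 mul1r. Qed.
Lemma dotDl x y z : ip (x + y) z = ip x z + ip y z.
Proof. exact: linearDl. Qed.
Lemma dotDr x y z : ip z (x + y) = ip z x + ip z y.
Proof. by rewrite dotC dotDl !(dotC z). Qed.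
Lemma dotNl x z : ip (- x) z = - ip x z.
Proof. exact: linearNl. Qed.
Lemma dotNr x z : ip z (- x) = - ip z x.
Proof. by rewrite dotC dotNl (dotC z). Qed.
Lemma dotZl a x z : ip (a *: x) z = a * ip x z.
Proof. exact: linearZl_LR. Qed.
Lemma dotZr a x z : ip z (a *: x) = a * ip z x.
Proof. by rewrite dotC dotZl (dotC z). Qed.
Definition dotE := (dotDl, dotDr, dotNl, dotNr, dotZl, dotZr).
Lemma dot0l x : ip 0 x = 0.
Proof. by rewrite -(scale0r 0) dotZl mul0r. Qed.

Lemma dot_suml (I : finType) (F : I -> V) x :
  ip (\sum_i F i) x = \sum_i ip (F i) x.
Proof. by apply: (big_morph (ip^~ x)) => [u v|]; rewrite ?dotDl ?dot0l. Qed.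

Lemma dot_gt0 x : x != 0 -> 0 < ip x x.
Proof. exact: (neq0_dnorm_gt0 (s := ip)). Qed.
Lemma dot_ge0 x : 0 <= ip x x.
Proof.
have [->|x0] := eqVneq x 0; first by rewrite dot0l.
exact/ltW/dot_gt0.
Qed.
Lemma dot_eq0 x : ip x x = 0 -> x = 0.
Proof. by have [//|/dot_gt0/lt0r_neq0/eqP] := eqVneq x 0. Qed.

Lemma inorm_sqr x : inorm ip x ^+ 2 = ip x x.
Proof. by rewrite sqr_sqrtr // dot_ge0. Qed.

Lemma dot_ext u v : (forall x, ip u x = ip v x) -> u = v.
Proof.
move=> h; apply/eqP; rewrite -subr_eq0; apply/eqP/dot_eq0.
by rewrite dotDl dotNl h subrr.
Qed.

Lemma cV_sum_delta (m : nat) (x : 'cV[R]_m) : x = \sum_i x i 0 *: delta_mx i 0.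
Proof.
rewrite {1}(matrix_sum_delta x); apply: eq_bigr => i _.
by rewrite big_ord1.
Qed.

Lemma dot_coord x y : ip x y = \sum_i x i 0 * ip (delta_mx i 0) y.
Proof.
rewrite {1}(cV_sum_delta x) dot_suml.
by apply: eq_bigr => i _; rewrite dotZl.
Qed.

(* The Gram matrix of the standard basis is injective because [ip] is definite. *)
Lemma riesz (phi : {linear V -> R^o}) : exists v, forall x, phi x = ip x v.
Proof.
pose G : 'M[R]_n := \matrix_(i, j) ip (delta_mx i 0) (delta_mx j 0).
have GE v i : (G *m v) i 0 = ip (delta_mx i 0) v.
  rewrite dotC dot_coord mxE /=.
  by apply: eq_bigr => j _; rewrite mxE dotC mulrC.
have Gu : G \in unitmx.
  rewrite -unitmx_tr -row_free_unit -kermx_eq0.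
  apply/eqP/row_matrixP => i; rewrite row0; set k := row i _.
  have : k *m G^T = 0.
    by rewrite /k -row_mul mulmx_ker row0.
  move/(congr1 trmx); rewrite trmx_mul trmxK trmx0 => Gk.
  apply: trmx_inj; rewrite trmx0; apply: dot_eq0.
  rewrite dot_coord big1 //= => j _.
  by rewrite -GE Gk [X in _ * X]mxE mulr0.
exists (invmx G *m \col_i phi (delta_mx i 0)) => x.
rewrite dot_coord {1}(cV_sum_delta x) linear_sum /=.
apply: eq_bigr => i _; rewrite -GE mulmxA mulmxV // mul1mx mxE.
by rewrite linearZ.
Qed.

Lemma dot_le_half x v : `|ip x v| <= (ip x x + ip v v) / 2.
Proof.
have := dot_ge0 (x + v); have := dot_ge0 (x - v); rewrite !dotE (dotC v x).
by rewrite ler_norml; lra.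
Qed.

(** By [riesz] a coordinate is the pairing with a fixed vector, which [dot_le_half] bounds. *)
Lemma coord_dot_bounded (i : 'I_n) (r : R) :
  exists M, forall x, ip x x <= r -> `|x i 0| <= M.
Proof.
pose phi : V -> R^o := fun x => x i 0.
have phil : linear phi by move=> a x y; rewrite /phi !mxE.
pose phiL : {linear V -> R^o} := HB.pack phi
  (GRing.isLinear.Build _ _ _ _ phi phil).
have [v hv] := riesz phiL.
exists ((r + ip v v) / 2) => x xr.
have -> : x i 0 = ip x v by rewrite -hv.
have := dot_le_half x v; lra.
Qed.

(** Coordinate bounds enclose the ball in a box; the box is formed among row vectors, where
    [rV_compact] applies, and transposed. *)
Lemma dot_ball_sub_compact x0 (r : R) :
  exists2 K : set V, compact K & forall x, ip (x - x0) (x - x0) <= r -> K x.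
Proof.
have /choice[M hM] : forall i, exists M, forall x, ip x x <= r -> `|x i 0| <= M.
  by move=> i; exact: coord_dot_bounded.
pose A i : set R := `[x0 i 0 - M i, x0 i 0 + M i]%classic.
exists (trmx @` [set v : 'rV[R]_n | forall i, A i (v ord0 i)]).
  apply: continuous_compact; last first.
    by apply: rV_compact => i; exact: segment_compact.
  apply: continuous_subspaceT => v B [P vP PB].
  exists (fun i j => P j i) => [i j|w Pw]; first by have := vP j i; rewrite mxE.
  by apply: PB => i j; rewrite mxE; exact: Pw.
move=> x xr; exists x^T; last by rewrite trmxK.
move=> i; rewrite /A /= in_itv /= mxE.
by have := hM i _ xr; rewrite !mxE ler_norml; lra.
Qed.

Lemma cV_coord_le_norm (m : nat) (x : 'cV[R]_m) (i : 'I_m) : `|x i 0| <= `|x|.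
Proof.
rewrite [leRHS]/Num.norm /= mx_normrE; apply/bigmax_geP; right.
by exists (i, 0).
Qed.

(** Compares the inner product with the norm used for differentiability; [C] sums the absolute Gram
    entries of the images of the basis. *)
Lemma dot_linear_le_norm_sqr (m : nat) (L : {linear 'cV[R]_m -> V}) :
  exists C, forall d, ip (L d) (L d) <= C * `|d| ^+ 2.
Proof.
have LE d z : ip (L d) z = \sum_i d i 0 * ip (L (delta_mx i 0)) z.
  rewrite {1}(cV_sum_delta d) linear_sum dot_suml.
  by apply: eq_bigr => i _; rewrite linearZ dotZl.
exists (\sum_i \sum_j `|ip (L (delta_mx i 0)) (L (delta_mx j 0))|) => d.
rewrite LE mulr_suml; apply: ler_sum => i _.
rewrite dotC LE mulr_sumr mulr_suml; apply: ler_sum => j _; rewrite dotC mulrA.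
rewrite (le_trans (ler_norm _))// normrM mulrC ler_wpM2l// normrM expr2.
by rewrite ler_pM// cV_coord_le_norm.
Qed.

Lemma dotr_continuous v : continuous (fun x => ip x v).
Proof.
have -> : (fun x => ip x v) = (fun x => \sum_i x i 0 * ip (delta_mx i 0) v).
  by apply/funext => x; rewrite dot_coord.
apply: continuous_big => [|i _ x]; first exact: add_continuous.
apply: (@continuousM R V (fun x => x i 0) (cst (ip (delta_mx i 0) v)) x).
  exact: coord_continuous.
exact: cst_continuous.
Qed.

Lemma dot_sqr_continuous : continuous (fun x => ip x x).
Proof.
have -> : (fun x => ip x x) = (fun x => \sum_i x i 0 * ip x (delta_mx i 0)).
  apply/funext => x; rewrite dot_coord.
  by apply: eq_bigr => i _; rewrite dotC.
apply: continuous_big => [|i _ x]; first exact: add_continuous.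
apply: (@continuousM R V (fun x => x i 0) (ip^~ (delta_mx i 0)) x).
  exact: coord_continuous.
exact: dotr_continuous.
Qed.

Lemma is_gradient_quadratic (h : V -> \bar R) y v C :
  (forall w, h w \is a fin_num) ->
  (forall d, `|fine (h (d + y)) - fine (h y) - ip v d| <= C * `|d| ^+ 2) ->
  is_gradient ip h y v.
Proof.
move=> hfin hC.
have phil : linear (ip v : V -> R^o) by move=> a x z; rewrite dotDr dotZr.
pose L : {linear V -> R} := HB.pack (ip v : V -> R)
  (GRing.isLinear.Build _ _ _ _ (ip v : V -> R^o) phil).
have LC : continuous L.
  by have := @dotr_continuous v; under eq_fun do rewrite dotC.
have [df dL] := @differentiable_quadratic _ _ (fine \o h : V -> R) L y C LC hC.
by split=> [||u]; [near=> w; exact: hfin| |rewrite dL].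
Unshelve. all: by end_near. Qed.

Lemma is_gradient_inj (h : V -> \bar R) y u v :
  is_gradient ip h y u -> is_gradient ip h y v -> u = v.
Proof. by move=> [_ _ hu] [_ _ hv]; apply: dot_ext => x; rewrite -hu -hv. Qed.

Lemma gradientE (h : V -> \bar R) y v :
  is_gradient ip h y v -> gradient ip h y = v.
Proof.
move=> hv; rewrite /gradient; apply: xget_unique => // u hu.
exact: is_gradient_inj hu hv.
Qed.

End DotTheory.

(** * Strong convexity on epigraphs and existence of minimizers *)

Section Minimizers.
Local Open Scope classical_set_scope.
Context {R : realType} {n : nat} (ip : {dot 'cV[R]_n for idfun}).
Local Notation V := 'cV[R]_n.
Implicit Types (x y u v w : V) (h : V -> \bar R) (a b t r : R).

(* Strong convexity in terms of the epigraph: the bounds [a] and [b] are real, so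
   no arithmetic with infinities is involved. *)
Definition epi_convex mu h := forall x y a b t, (0 <= t <= 1)%R ->
  h x <= a%:E -> h y <= b%:E ->
  h (t *: x + (1 - t) *: y)%R <=
    (t * a + (1 - t) * b - mu / 2 * (t * (1 - t)) * ip (x - y) (x - y))%:E.

Lemma convex_fun_fin h x y a b t : convex_fun h -> (0 <= t <= 1)%R ->
  h x <= a%:E -> h y <= b%:E ->
  h (t *: x + (1 - t) *: y)%R <= (t * a + (1 - t) * b)%:E.
Proof.
move=> hc t01 ha hb; apply: (le_trans (hc x y t t01)).
rewrite [leRHS]EFinD !EFinM; have /andP[t0 t1] := t01.
by rewrite leeD// lee_wpmul2l// lee_fin// subr_ge0.
Qed.

Lemma convex_epi_convex h : convex_fun h -> epi_convex 0 h.
Proof.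
by move=> hc x y a b t t01 ha hb; rewrite !mul0r subr0; exact: convex_fun_fin.
Qed.

(** The modulus term is the convexity defect of the squared norm, which equals $t(1-t)\|x-y\|^2$. *)
Lemma strongly_convex_epi_convex mu h :
  strongly_convex ip mu h -> epi_convex mu h.
Proof.
move=> hc x y a b t t01 ha hb.
pose q x := (mu / 2 * inorm ip x ^+ 2)%R.
have := @convex_fun_fin (fun x => h x - (q x)%:E) x y (a - q x)%R (b - q y)%R
  t hc t01.
rewrite !EFinB !leeB// => /(_ isT isT).
rewrite leeBlDr// -EFinD => /le_trans; apply.
rewrite lee_fin /q !inorm_sqr !dotE (dotC ip y x).
by rewrite le_eqVlt; apply/orP; left; apply/eqP; field.
Qed.

(** The identity on [q] holds for affine functions with [nu = 0] and for quadratic penalties with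
    [nu] their modulus, so both perturbations are covered. *)
Lemma epi_convexD mu nu h (q : V -> R) : epi_convex mu h ->
  (forall x y t, q (t *: x + (1 - t) *: y) =
    t * q x + (1 - t) * q y - nu / 2 * (t * (1 - t)) * ip (x - y) (x - y))%R ->
  epi_convex (mu + nu) (fun x => h x + (q x)%:E).
Proof.
move=> hc hq x y a b t t01; rewrite -!leeBrDr// -!EFinB => ha hb.
apply: (le_trans (hc _ _ _ _ _ t01 ha hb)); rewrite lee_fin hq.
by rewrite le_eqVlt; apply/orP; left; apply/eqP; field.
Qed.

(** The epigraph of the sum is the preimage of that of [h] under the continuous shear [s]. *)
Lemma closed_funD h (q : V -> R) : closed_fun h -> continuous q ->
  closed_fun (fun x => h x + (q x)%:E).
Proof.
move=> hcl qc; rewrite /closed_fun.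
pose s (p : V * R) : V * R := (p.1, p.2 - q p.1)%R.
rewrite (_ : [set p | _] = s @^-1` [set p | h p.1 <= p.2%:E]); last first.
  by apply/seteqP; split => -[x r] /=; rewrite EFinB leeBrDr.
apply: preimage_closed hcl => p _.
have c1 : (fun p : V * R => p.1) @ p --> p.1 by exact: cvg_fst.
have c2 : (fun p : V * R => p.2) @ p --> p.2 by exact: cvg_snd.
have c3 : (fun p : V * R => q p.1) @ p --> q p.1.
  exact: (cvg_comp _ _ c1 (qc p.1)).
exact: (@cvg_pair _ _ _ (nbhs p) (nbhs p.1) (nbhs (p.2 - q p.1)%R) _ _ _ _ _
  c1 (cvgB c2 c3)).
Qed.

Lemma closed_sublevel h b : closed_fun h -> closed [set x | h x <= b%:E].
Proof.
move=> hcl; rewrite (_ : [set x | _] =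
  (fun x => (x, b)) @^-1` [set p : V * R | h p.1 <= p.2%:E])//.
apply: preimage_closed hcl => x _.
exact: (@cvg_pair _ _ _ (nbhs x) (nbhs x) (nbhs b) _ _ _ _ _
  cvg_id (cvg_cst b)).
Qed.

(** The nonempty sublevel sets of [h] in [K] generate a proper filter; being closed, they all
    contain its cluster points. *)
Lemma compact_min h (K : set V) x0 : closed_fun h -> (forall x, h x != -oo) ->
  compact K -> K x0 -> exists2 x, K x & forall w, K w -> h x <= h w.
Proof.
move=> hcl hNy Kc Kx0.
pose D := [set b : R | exists2 w, K w & h w <= b%:E].
(* If [D] is empty, [h] is [+oo] on all of [K] and [x0] is already a minimizer. *)
have [[b0 Db0]|D0] := pselect (D !=set0); last first.
  exists x0 => // w Kw; case E : (h w) => [r| |]; last by move: (hNy w); rewrite E.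
    by exfalso; apply: D0; exists r; exists w; rewrite ?E.
  exact: leey.
pose B b := K `&` [set x | h x <= b%:E].
have Ff : Filter (filter_from D B).
  apply: filter_from_filter; first by exists b0.
  move=> i j Di Dj; exists (Num.min i j).
    by rewrite /Num.min; case: ifP.
  move=> x [Kx /= hx]; split; split => //=; apply: (le_trans hx);
  by rewrite lee_fin ge_min lexx ?orbT.
have Fp : ProperFilter (filter_from D B).
  by apply: filter_from_proper => // b [w Kw hw]; exists w; split.
have [p [Kp clp]] : K `&` cluster (filter_from D B) !=set0.
  by apply: Kc; exists b0 => // x [].
exists p => // w Kw; case E : (h w) => [r| |]; last by move: (hNy w); rewrite E.
  suff : closure [set x | h x <= r%:E] p.
    by rewrite -((closure_id _).1 (closed_sublevel (b := r) hcl)).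
  move=> U pU.
  have Dr : D r by exists w => //; rewrite E.
  have [x [[_ hx] Ux]] := clp (B r) U (ex_intro2 _ _ r Dr (fun _ => id)) pU.
  by exists x.
exact: leey.
Qed.

Lemma epi_convex_min mu h : (0 < mu)%R -> proper_fun h -> closed_fun h ->
  epi_convex mu h -> exists x, forall w, h x <= h w.
Proof.
move=> mu0 [hNy [x0 hx0]] hcl hc.
have finP x r : h x <= r%:E -> exists2 s : R, h x = s%:E & (s <= r)%R.
  move: (hNy x); case: (h x) => [s| |]// _.
  by rewrite lee_fin => ?; exists s.
have [a0 ha0] : exists a0, h x0 = a0%:E.
  by move: hx0 (hNy x0); case: (h x0) => // r; exists r.
have [K1 K1c K1b] := dot_ball_sub_compact ip x0 1.
have K1x0 : K1 x0 by apply: K1b; rewrite subrr dot0l.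
have [p1 _ p1min] := compact_min hcl hNy K1c K1x0.
have [m hm ma0] : exists2 m : R, h p1 = m%:E & (m <= a0)%R.
  by apply: finP; rewrite -ha0; exact: p1min.
(* Convexity between [w] and [x0], evaluated on the unit sphere around [x0] where
   [h] is at least [m], forces [h w > a0] when [w] is at distance more than [rho]. *)
pose rho := (1 + 2 * (a0 - m) / mu)%R.
have rho1 : (1 <= rho)%R.
  by rewrite lerDl divr_ge0// ?(ltW mu0)// mulr_ge0// subr_ge0.
have [K2 K2c K2b] := dot_ball_sub_compact ip x0 (rho ^+ 2).
have K2x0 : K2 x0 by apply: K2b; rewrite subrr dot0l sqr_ge0.
have [p2 _ p2min] := compact_min hcl hNy K2c K2x0.
exists p2 => w; rewrite leNgt; apply/negP => hw.
have wa0 : h w <= a0%:E by rewrite -ha0 (le_trans (ltW hw))// p2min.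
have : (rho < inorm ip (w - x0))%R.
  rewrite ltNge; apply/negP => wrho; move: hw; apply/negP; rewrite -leNgt.
  apply: p2min; apply: K2b; rewrite -inorm_sqr ler_sqr// nnegrE//.
    exact: sqrtr_ge0.
  by rewrite (le_trans _ rho1).
have := inorm_sqr ip (w - x0); set r := inorm ip _ => r2 rhor.
have r0 : (0 < r)%R by lra.
have r1 : (1 <= r)%R by lra.
have t01 : (0 <= r^-1 <= 1)%R by rewrite invr_ge0 ltW//= invf_le1.
have := hc w x0 a0 a0 (r^-1)%R t01 wa0.
rewrite ha0 lexx => /(_ isT); rewrite -r2 => hp.
have : h p1 <= h (r^-1 *: w + (1 - r^-1) *: x0)%R.
  apply: p1min; apply: K1b.
  rewrite (_ : _ - x0 = r^-1 *: (w - x0))%R; last first.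
    by rewrite scalerBl scale1r scalerBr addrA addrAC addrK.
  by rewrite dotZl dotZr -r2 expr2 mulKf ?mulVf// gt_eqF.
move=> /le_trans /(_ hp); rewrite hm lee_fin.
(* The bound becomes [m <= a0 - mu / 2 * (r - 1)], which the choice of [rho] contradicts. *)
have -> : (r^-1 * a0 + (1 - r^-1) * a0 - mu / 2 * (r^-1 * (1 - r^-1)) * r ^+ 2
  = a0 - mu / 2 * (r - 1))%R by field; rewrite gt_eqF.
move: rhor; rewrite /rho -ltrBrDl ltr_pdivrMr// => *; lra.
Qed.

End Minimizers.

(** * Quadratic growth around minimizers *)

Section ConvexMinimum.
Local Open Scope classical_set_scope.
Context {R : realType} {n : nat} (ip : {dot 'cV[R]_n for idfun}).
Local Notation V := 'cV[R]_n.
Implicit Types (x y u v w z : V) (h : V -> \bar R) (a b t r : R).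

Lemma argminP h : (exists x, forall w, h x <= h w) ->
  forall w, h (argmin h) <= h w.
Proof.
move=> [x hx].
exact: (@xgetPex _ 0%R [set x | forall w, h x <= h w] (ex_intro _ x hx)).
Qed.

(** If growth failed at [w], some point of the segment from [x] to [w] would have a value below the
    minimum. *)
Lemma epi_convex_min_growth mu h x a : epi_convex ip mu h -> h x = a%:E ->
  (forall w, h x <= h w) ->
  forall w, (a + mu / 2 * ip (w - x) (w - x))%:E <= h w.
Proof.
move=> hc hx xmin w; have := xmin w; rewrite hx.
case E : (h w) => [b| |]//; last by move=> _; rewrite leey.
rewrite !lee_fin => ab; set k := (mu / 2 * _)%R.
rewrite leNgt; apply/negP => bk.
(* [e] is the amount by which growth fails. Below, [t] solves [e - t * k = t * e], so convexity
   bounds the value at parameter [t] by [a - t * (t * e) < a]. *)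
pose e := (a + k - b)%R; have e0 : (0 < e)%R by rewrite subr_gt0.
have k0 : (0 < k)%R by rewrite -(ltrD2l a) addr0 (le_lt_trans ab).
pose t := (e / (e + k))%R.
have ek0 : (0 < e + k)%R by rewrite addr_gt0.
have tE : (t * (e + k) = e)%R by rewrite /t mulfVK// gt_eqF.
have t0 : (0 < t)%R by rewrite divr_gt0.
have t1 : (t < 1)%R by rewrite ltr_pdivrMr// mul1r ltrDl.
have := hc w x b a t; rewrite hx E !lexx (ltW t0) (ltW t1) => /(_ isT isT isT).
move=> /(le_trans (xmin _)); rewrite hx lee_fin.
have -> : (mu / 2 * (t * (1 - t)) * ip (w - x) (w - x) = k * (t * (1 - t)))%R.
  by rewrite /k; ring.
have -> : (t * b + (1 - t) * a - k * (t * (1 - t)) =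
  a - t * (e - t * k))%R by rewrite /e; ring.
have -> : (e - t * k = t * e)%R by rewrite -{1}tE; ring.
have := mulr_gt0 t0 (mulr_gt0 t0 e0); lra.
Qed.

(** Moving [q] to the other side of the growth bound leaves a minorant of [h] alone. The modulus may
    come from [h] (for [xmin]) or from [q] (for [zmin]). *)
Lemma argmin_growth mu nu h (q : V -> R) : (0 < mu + nu)%R ->
  proper_fun h -> closed_fun h -> epi_convex ip mu h -> continuous q ->
  (forall x y t, q (t *: x + (1 - t) *: y) =
    t * q x + (1 - t) * q y - nu / 2 * (t * (1 - t)) * ip (x - y) (x - y))%R ->
  let x := argmin (fun x => h x + (q x)%:E) in
  exists2 a, h x = a%:E & forall w,
    (a + q x - q w + (mu + nu) / 2 * ip (w - x) (w - x))%:E <= h w.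
Proof.
move=> munu [hNy [x1 hx1]] hcl hc qc hq x.
have hqc := epi_convexD hc hq.
have pr : proper_fun (fun x => h x + (q x)%:E).
  split; last by exists x1; rewrite lte_add_pinfty ?ltry.
  by move=> y; move: (hNy y); case: (h y).
have xmin := argminP (epi_convex_min munu pr (closed_funD hcl qc) hqc).
rewrite -/x in xmin.
have [a ha] : exists a, h x = a%:E.
  move: (xmin x1) (hNy x) hx1 (hNy x1).
  by case: (h x) => [a _ _ _ _| |]//; [exists a|case: (h x1)].
exists a => // w.
have hqx : h x + (q x)%:E = (a + q x)%:E by rewrite ha.
have := epi_convex_min_growth hqc hqx xmin w.
by rewrite -leeBlDr// -EFinB addrAC.
Qed.

End ConvexMinimum.

(** * Fenchel conjugates: subgradients, gradients and proximal points *)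

Section Conjugate.
Local Open Scope classical_set_scope.
Context {R : realType} {n : nat} (ip : {dot 'cV[R]_n for idfun}).
Local Notation V := 'cV[R]_n.
Implicit Types (x y u v w z : V) (h : V -> \bar R) (a b t r : R).

Lemma conjugate_ge h v x : (ip v x)%:E - h x <= conjugate ip h v.
Proof. by apply: ereal_sup_ubound; exists x. Qed.

Lemma conjugate_ge_fin h v x a : h x = a%:E ->
  (ip v x - a)%:E <= conjugate ip h v.
Proof. by move=> hx; rewrite EFinB -hx; exact: conjugate_ge. Qed.

Lemma conjugate_le h v b : (forall x, (ip v x - b)%:E <= h x) ->
  conjugate ip h v <= b%:E.
Proof.
move=> hb; apply: ge_ereal_sup => _ [x _ <-].
have := hb x; case: (h x) => [r| |]//; last by rewrite leNye.
by rewrite -EFinB !lee_fin; lra.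
Qed.

(** Fenchel's equality: the subgradient inequality makes [x] attain the supremum. *)
Lemma conjugate_subgradient h v x a : h x = a%:E ->
  (forall w, (a + ip v (w - x))%:E <= h w) ->
  conjugate ip h v = (ip v x - a)%:E.
Proof.
move=> hx sub; apply/eqP; rewrite eq_le conjugate_ge_fin// andbT.
apply: conjugate_le => w; apply: le_trans (sub w).
by rewrite lee_fin !dotE; lra.
Qed.

(** Growth of [h] at [x] dualizes to smoothness of the conjugate at [v], with slope [x]. *)
Lemma conjugate_quadratic h mu v x a : (0 < mu)%R -> h x = a%:E ->
  (forall w, (a + ip v (w - x) + mu / 2 * ip (w - x) (w - x))%:E <= h w) ->
  forall u, conjugate ip h u <=
    (ip u x - a + 1 / (2 * mu) * ip (u - v) (u - v))%:E.
Proof.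
move=> mu0 hx sub u; apply: conjugate_le => w; apply: le_trans (sub w).
rewrite lee_fin -subr_ge0.
(* Completing the square: the gap between the two sides is a multiple of a squared norm. *)
rewrite [leRHS](_ : _ = 1 / (2 * mu) *
  ip (mu *: (w - x) - (u - v)) (mu *: (w - x) - (u - v)))%R.
  by rewrite mulr_ge0 ?dot_ge0// divr_ge0// mulr_ge0// ltW.
rewrite !dotE (dotC ip x w) (dotC ip u w) (dotC ip v w) (dotC ip u x).
by rewrite (dotC ip v x) (dotC ip v u); field; rewrite gt_eqF.
Qed.

Lemma conjugate_fin h mu v x a : (0 < mu)%R -> h x = a%:E ->
  (forall w, (a + ip v (w - x) + mu / 2 * ip (w - x) (w - x))%:E <= h w) ->
  forall u, conjugate ip h u \is a fin_num.
Proof.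
move=> mu0 hx sub u.
have := conjugate_quadratic mu0 hx sub u; have := conjugate_ge_fin u hx.
by case: (conjugate ip h u).
Qed.

(** The linearization error lies between 0, by the affine minorant from [x], and the bound of
    [conjugate_quadratic]. A general [L] serves both $f^*(-A^\top\cdot)$ and, as the identity,
    $f^*$. *)
Lemma gradient_conjugate_linear (m : nat) (ipm : {dot 'cV[R]_m for idfun})
    (L : {linear 'cV[R]_m -> V}) h mu x a (y v : 'cV[R]_m) :
  (0 < mu)%R -> h x = a%:E ->
  (forall w, (a + ip (L y) (w - x) + mu / 2 * ip (w - x) (w - x))%:E <= h w) ->
  (forall d, ipm v d = ip (L d) x) ->
  is_gradient ipm (fun y : 'cV[R]_m => conjugate ip h (L y)) y v.
Proof.
move=> mu0 hx sub vE.
have hfin := conjugate_fin mu0 hx sub.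
have [C hC] := dot_linear_le_norm_sqr ip L.
apply: (@is_gradient_quadratic _ _ _ _ _ _ (1 / (2 * mu) * C)%R) => [//|d].
have cy : conjugate ip h (L y) = (ip (L y) x - a)%:E.
  apply: conjugate_subgradient => // w; apply: le_trans (sub w).
  by rewrite lee_fin lerDl mulr_ge0 ?dot_ge0// divr_ge0// ltW.
have [c hc] : exists c, conjugate ip h (L (d + y)%R) = c%:E.
  by exists (fine (conjugate ip h (L (d + y)%R))); rewrite fineK.
have := conjugate_ge_fin (L (d + y)%R) hx; rewrite hc lee_fin => lec.
have := conjugate_quadratic mu0 hx sub (L (d + y)%R); rewrite hc lee_fin.
rewrite cy /= vE; move: lec; rewrite linearD addrK dotDl => lec gec.
rewrite ger0_norm; last by lra.
apply: (@le_trans _ _ (1 / (2 * mu) * ip (L d) (L d))%R); first by lra.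
by rewrite -[leRHS]mulrA ler_wpM2l// divr_ge0// mulr_ge0// ltW.
Qed.

(** The epigraph is an intersection of closed half-spaces, one for each [z] with [h z] finite. *)
Lemma conjugate_closed h : (forall x, h x != -oo) -> closed_fun (conjugate ip h).
Proof.
move=> hNy; rewrite /closed_fun.
pose H z := [set p : V * R | (ip p.1 z)%:E - h z <= p.2%:E].
rewrite (_ : [set p | _] = \bigcap_z H z); last first.
  apply/seteqP; split => p /= hp.
    by move=> z _; apply: le_trans hp; exact: conjugate_ge.
  by apply: ge_ereal_sup => _ [z _ <-]; exact: hp.
apply: closed_bigI => z _; rewrite /H.
case E : (h z) => [s| |]; last by move: (hNy z); rewrite E.
  rewrite (_ : [set p | _] =
      (fun p : V * R => ip p.1 z - p.2)%R @^-1` [set r | (r <= s)%R]).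
    apply: preimage_closed; last exact: closed_le.
    move=> p _.
    have c1 : (fun p : V * R => p.1) @ p --> p.1 by exact: cvg_fst.
    have c2 : (fun p : V * R => p.2) @ p --> p.2 by exact: cvg_snd.
    apply: cvgB c2.
    exact: (cvg_comp _ _ c1 (@dotr_continuous _ _ ip z p.1)).
  by apply/seteqP; split => -[x r] /=; rewrite -EFinB lee_fin; lra.
rewrite (_ : [set p | _] = setT); first exact: closedT.
by apply/seteqP; split => // p _ /=; rewrite leNye.
Qed.

Lemma conjugate_convex h : (forall x, h x != -oo) -> convex_fun (conjugate ip h).
Proof.
move=> hNy x y t /andP[t0 t1]; apply: ge_ereal_sup => _ [z _ <-].
have := hNy z; case E : (h z) => [s| |]// _; last by rewrite leNye.
rewrite -EFinB [leLHS](_ : _ =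
    t%:E * (ip x z - s)%:E + (1 - t)%:E * (ip y z - s)%:E); last first.
  by rewrite -!EFinM -EFinD !dotE; congr (_%:E); ring.
by rewrite leeD// lee_wpmul2l// ?lee_fin ?subr_ge0//; exact: conjugate_ge_fin.
Qed.

(** Conjugation inverts subgradients: [z] is a subgradient of the conjugate at [w0], and [z] is
    $(v-w_0)/\gamma$, the optimality condition of the prox. *)
Lemma prox_conjugate gamma h v z s : (0 < gamma)%R -> h z = s%:E ->
  (forall w, (s + ip (v - gamma *: z)%R (w - z))%:E <= h w) ->
  prox ip gamma (conjugate ip h) v = (v - gamma *: z)%R.
Proof.
move=> gamma0 hz sub; set w0 := (v - gamma *: z)%R.
have c0 : conjugate ip h w0 = (ip w0 z - s)%:E by exact: conjugate_subgradient.
(* The remainder in [w - w0] yields both minimality of [w0] and its uniqueness; the latter forces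
   [xget] to return [w0]. *)
have key w : (ip w0 z - s + 1 / (2 * gamma) * inorm ip (w0 - v) ^+ 2 +
    1 / (2 * gamma) * ip (w - w0) (w - w0))%:E <=
    conjugate ip h w + (1 / (2 * gamma) * inorm ip (w - v) ^+ 2)%:E.
  rewrite -leeBlDr//; apply: le_trans (conjugate_ge_fin w hz).
  rewrite -EFinB lee_fin !inorm_sqr /w0 !dotE.
  rewrite (dotC ip v w) (dotC ip z w) (dotC ip v z).
  by rewrite le_eqVlt; apply/orP; left; apply/eqP; field; rewrite gt_eqF.
rewrite /prox /argmin; apply: xget_unique => [w|w /= wmin].
  rewrite c0; apply: le_trans (key w); rewrite lee_fin lerDl.
  by rewrite mulr_ge0 ?dot_ge0// divr_ge0// mulr_ge0// ltW.
have := le_trans (key w) (wmin w0); rewrite c0 -EFinD lee_fin gerDl => ww.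
apply/eqP; rewrite -subr_eq0; apply/eqP/(@dot_eq0 _ _ ip)/eqP.
rewrite eq_le dot_ge0 andbT.
by move: ww; rewrite pmulr_rle0// divr_gt0// mulr_gt0.
Qed.

End Conjugate.

(** * The adjoint of [A] *)

Section Adjoint.
Local Open Scope ring_scope.
Local Open Scope classical_set_scope.
Context {R : realType} {n m : nat}.
Variables (ipn : {dot 'cV[R]_n for idfun}) (ipm : {dot 'cV[R]_m for idfun}).
Variable A : {linear 'cV[R]_n -> 'cV[R]_m}.
Local Notation At := (adjoint ipn ipm A).

(** [riesz] supplies a witness, so [xget] does not fall back on its default. *)
Lemma adjointP x y : ipm (A x) y = ipn x (At y).
Proof.
pose phi x : R^o := ipm (A x) y.
have phil : linear phi.
  by move=> a u v; rewrite /phi linearD linearZ dotDl dotZl.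
pose phiL : {linear 'cV[R]_n -> R^o} := HB.pack phi
  (GRing.isLinear.Build _ _ _ _ phi phil).
have [v hv] := riesz ipn phiL.
exact: (@xgetPex _ 0 [set v | forall x, ipm (A x) y = ipn x v]
  (ex_intro _ v hv) x).
Qed.

Lemma opp_adjoint_linear : linear (fun y => - At y).
Proof.
move=> a u v; apply: (@dot_ext _ _ ipn) => x.
by rewrite !(dotC ipn _ x) !dotE -!adjointP !dotE; ring.
Qed.

End Adjoint.

Theorem mainTheorem1 (R : realType) (n m : nat)
    (ipn : {dot 'cV[R]_n for idfun}) (ipm : {dot 'cV[R]_m for idfun})
    (A : {linear 'cV[R]_n -> 'cV[R]_m})
    (f : 'cV[R]_n -> \bar R) (g : 'cV[R]_m -> \bar R) (mu gamma : R)
    (mu_gt0 : (0 < mu)%R)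
    (f_proper : proper_fun f) (f_closed : closed_fun f)
    (f_sconvex : strongly_convex ipn mu f)
    (g_proper : proper_fun g) (g_closed : closed_fun g) (g_convex : convex_fun g)
    (dom_fg : exists x, f x < +oo /\ g (A x) < +oo)
    (gamma_gt0 : (0 < gamma)%R) :
  let At := adjoint ipn ipm A in
  let x_ := xmin ipm A f in
  let z_ := zmin ipm A f g gamma in
  let T := fb_step ipn ipm A f g gamma in
  let psi := alternating_minimization_envelope ipm A f g gamma in
  is_forward_backward_envelope ipm gamma
    (fun y => conjugate ipn f (- At y)%R) (conjugate ipm g) psi
  /\ forall y : 'cV[R]_m,
       psi y = conjugate ipn f (- At y)%R + conjugate ipm g (T y)
               + (gamma / 2 * inorm ipm (A (x_ y) - z_ y) ^+ 2)%:E
               + (gamma * ipm (A (x_ y)) (z_ y - A (x_ y)))%:E.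
Proof.
move=> At x_ z_ T psi.
(* Optimality of $x(y)$: $-A^\top y$ is a subgradient of [f] there, with growth [mu]. *)
have xP y : exists2 a, f (x_ y) = a%:E & forall w,
    (a + ipn (- At y) (w - x_ y) + mu / 2 * ipn (w - x_ y) (w - x_ y))%:E
      <= f w.
  have qE : (fun x => ipm y (A x)) = (fun x => ipn x (At y)).
    by apply/funext => x; rewrite dotC (adjointP ipn).
  have [||||||a ha fx] := @argmin_growth _ _ ipn mu 0 f
    (fun x => ipm y (A x)) => //.
  - by rewrite addr0.
  - exact: strongly_convex_epi_convex.
  - by rewrite qE; exact: dotr_continuous.
  - by move=> x x' t; rewrite (linearD A) !(linearZ_LR A) /= !dotE; ring.
  rewrite -[argmin _]/(x_ y) in ha fx; exists a => // w.
  apply: le_trans (fx w); rewrite lee_fin addr0.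
  have -> : (ipn (- At y) (w - x_ y) = ipm y (A (x_ y)) - ipm y (A w))%R.
    by rewrite !dotE !(dotC ipn (At y)) -!(adjointP ipn) !(dotC ipm y); ring.
  lra.
(* Here the growth term [gamma] cancels the quadratic part of the penalty, leaving an affine
   minorant of [g] whose slope will turn out to be [T y]. *)
have zP y : exists2 s, g (z_ y) = s%:E & forall w,
    (s + ipm (y + gamma *: (A (x_ y) - z_ y)) (w - z_ y))%:E <= g w.
  have [a ha _] := xP y.
  (* The constant [a] makes [g + q] the augmented Lagrangian itself, so the two [argmin] agree. *)
  pose q z := (a + ipm y (A (x_ y) - z) +
               gamma / 2 * ipm (A (x_ y) - z) (A (x_ y) - z))%R.
  have qc : continuous q.
    set p := A (x_ y) in q *.
    have -> : q = (cst (a + ipm y p + gamma / 2 * ipm p p) +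
        (fun z => ipm z (- y - gamma *: p)) +
        cst (gamma / 2) * (fun z => ipm z z))%R.
      apply/funext => z; rewrite !fctE /q !dotE (dotC ipm z y) (dotC ipm z p).
      by field.
    move=> z; apply: continuousD.
      apply: continuousD; first exact: cst_continuous.
      exact: dotr_continuous.
    apply: continuousM; first exact: cst_continuous.
    exact: dot_sqr_continuous.
  have [||||||s hs gz] := @argmin_growth _ _ ipm 0 gamma g q => //.
  - by rewrite add0r.
  - exact: convex_epi_convex.
  - move=> z z' t; rewrite /q !dotE.
    rewrite (dotC ipm z (A _)) (dotC ipm z' (A _)) (dotC ipm z' z).
    by field.
  have zE : argmin (fun z => g z + (q z)%:E) = z_ y.
    congr argmin; apply/funext => z.
    rewrite /augmented_lagrangian -/x_ ha inorm_sqr /q !EFinD.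
    by rewrite (addeC a%:E (g z)) !addeA.
  rewrite zE in hs gz; exists s => // w; apply: le_trans (gz w).
  rewrite lee_fin /q !dotE add0r.
  rewrite !(dotC ipm _ (A _)) (dotC ipm w (z_ y)).
  by rewrite le_eqVlt; apply/orP; left; apply/eqP; field.
have gNy := g_proper.1.
pose L : {linear 'cV[R]_m -> 'cV[R]_n} := HB.pack (fun y => - At y)%R
  (GRing.isLinear.Build _ _ _ _ _ (opp_adjoint_linear ipn ipm A)).
have gradF y : is_gradient ipm (fun y => conjugate ipn f (- At y)%R) y
    (- A (x_ y))%R.
  have [a ha fx] := xP y.
  apply: (@gradient_conjugate_linear _ _ ipn _ ipm L f mu (x_ y) a) => // d.
  by rewrite dotNl (adjointP ipn) dotNl (dotC ipn (At d)).
have gradf y : gradient ipn (conjugate ipn f) (- At y)%R = x_ y.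
  have [a ha fx] := xP y.
  apply: gradientE.
  (* The identity as [L] gives the gradient of $f^*$ itself. *)
  apply: (@gradient_conjugate_linear _ _ ipn _ ipn idfun f mu (x_ y) a) => // d.
  exact: dotC.
have TE y : T y = (y + gamma *: (A (x_ y) - z_ y))%R.
  have [s hs gz] := zP y.
  rewrite /T /fb_step gradf (prox_conjugate gamma_gt0 hs).
    by rewrite scalerBr addrA.
  by rewrite -addrA -scalerBr.
have cf y a : f (x_ y) = a%:E ->
    conjugate ipn f (- At y)%R = (- ipm y (A (x_ y)) - a)%:E.
  move=> ha; have [a' ha' fx] := xP y.
  move: ha'; rewrite ha => -[aa]; rewrite -aa in fx.
  rewrite (conjugate_subgradient ha).
    by rewrite dotNl (dotC ipn) -adjointP dotC.
  move=> w; apply: le_trans (fx w).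
  by rewrite lee_fin lerDl mulr_ge0 ?dot_ge0// divr_ge0// ltW.
have cg y s : g (z_ y) = s%:E ->
    conjugate ipm g (T y) = (ipm (T y) (z_ y) - s)%:E.
  move=> hs; have [s' hs' gz] := zP y.
  move: hs'; rewrite hs => -[ss]; rewrite -ss in gz.
  by apply: conjugate_subgradient => //; rewrite TE.
have psiE y a s : f (x_ y) = a%:E -> g (z_ y) = s%:E ->
    psi y = (- (a + s + ipm y (A (x_ y) - z_ y) + gamma / 2 *
      ipm (A (x_ y) - z_ y) (A (x_ y) - z_ y)))%:E.
  move=> ha hs; rewrite /psi /alternating_minimization_envelope.
  by rewrite /augmented_lagrangian -/x_ -/z_ ha hs inorm_sqr.
split; last first.
  move=> y; have [a ha _] := xP y; have [s hs _] := zP y.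
  rewrite (psiE _ _ _ ha hs) (cf _ _ ha) (cg _ _ hs) -!EFinD inorm_sqr TE.
  congr (_%:E); rewrite !dotE !(dotC ipm _ (A _)).
  by field.
split.
- by move=> y; exists (- A (x_ y))%R.
- split; [split|exact: conjugate_closed|exact: conjugate_convex].
    (* Properness of $g^*$: a point where [g] is finite excludes [-oo], and Fenchel's equality makes
       the value at [T 0] finite. *)
    move=> w; have [s hs _] := zP 0%R.
    by have := conjugate_ge_fin ipm w hs; case: (conjugate ipm g w).
  by exists (T 0%R); have [s hs _] := zP 0%R; rewrite (cg _ _ hs) ltry.
move=> y; have [a ha _] := xP y; have [s hs _] := zP y.
rewrite (psiE _ _ _ ha hs) (cf _ _ ha) (gradientE (gradF y)).
split.
  exists (T y) => //.
  rewrite (cg _ _ hs) inorm_sqr -!EFinD TE; congr (_%:E).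
  rewrite !dotE !(dotC ipm _ (A _)) (dotC ipm (z_ y) y).
  by field; rewrite gt_eqF.
move=> _ [w _ <-].
have := conjugate_ge_fin ipm w hs.
case: (conjugate ipm g w) => [c| |]//; last by move=> _; rewrite leey.
rewrite inorm_sqr -!EFinD !lee_fin => wc.
(* With $g^*$ replaced by its affine minorant [wc], the envelope objective at [w] exceeds [psi y] by
   exactly this square. *)
have : (0 <= 1 / (2 * gamma) * ipm (w - T y) (w - T y))%R.
  by rewrite mulr_ge0 ?dot_ge0// divr_ge0// mulr_ge0// ltW.
rewrite [X in (0 <= X)%R -> _](_ : _ =
  (- ipm y (A (x_ y)) - a) + ipm (- A (x_ y)) (w - y) + (ipm w (z_ y) - s) +
  1 / (2 * gamma) * ipm (w - y) (w - y) + (a + s + ipm y (A (x_ y) - z_ y) +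
  gamma / 2 * ipm (A (x_ y) - z_ y) (A (x_ y) - z_ y)))%R; first by lra.
rewrite TE !dotE !(dotC ipm _ (A _)) (dotC ipm w y) (dotC ipm w (z_ y)).
rewrite (dotC ipm (z_ y) y).
by field; rewrite gt_eqF.
Qed.
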